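(* Let $\delta>k\ge 0$ be integers and let $n$ be sufficiently large (i.e. $n\ge n_0(k,\delta)$ for some $n_0$ depending only on $k$ and $\delta$). If $G$ is an $n$-vertex graph with minimum degree $\delta(G)\ge\delta$ and $$e(G)>e(H_{n,k,\delta+1}),$$ then $G$ is $k$-Hamiltonian unless $G\subseteq H_{n,k,\delta}$ or $G\subseteq L_{n,k,\delta}$.
   Context: All graphs are finite and simple; $e(G)$ is the number of edges of $G$, and $G\subseteq H$ means $G$ is (isomorphic to) a subgraph of $H$. $K_s$ is the complete graph on $s$ vertices, $I_t$ is the edgeless graph on $t$ vertices, $G\cup H$ is the disjoint union, and $G\vee H$ is the join (obtained from $G\cup H$ by adding all edges between $G$ and $H$). A graph is Hamiltonian if it has a Hamilton cycle (a cycle through all vertices). A graph $G=(V,E)$ is $k$-Hamiltonian if for all $S\subseteq V$ with $|S|\le k$, the subgraph induced by $V\setminus S$ is Hamiltonian. For integers $d>k\ge 0$ and $n$ large, define $$H_{n,k,d}:=K_d\vee(K_{n-2d+k}\cup I_{d-k}),\qquad L_{n,k,d}:=K_{k+1}\vee(K_{n-d-1}\cup K_{d-k}).$$ *)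

(* Defs.v *)
From mathcomp Require Import all_boot.

Set Implicit Arguments.
Unset Strict Implicit.
Unset Printing Implicit Defensive.

Record sgraph := SGraph {
  vertex :> finType;
  adj : rel vertex;
  adj_sym : symmetric adj;
  adj_irr : irreflexive adj }.
Arguments adj {G} x y : rename.
Arguments SGraph {vertex adj} _ _ : rename.

Definition edges (G : sgraph) : {set {set G}} :=
  [set A : {set G} | [exists x : G, exists y : G, adj x y && (A == [set x; y])]].
Definition num_edges (G : sgraph) : nat := #|edges G|.

Definition degree (G : sgraph) (v : G) : nat := #|[set w : G | adj v w]|.

(* Every degree is less than #|G|, so the default value #|G| of the iterated
   minimum never matters unless the graph is empty. *)
Definition min_degree (G : sgraph) : nat := \big[minn/#|G|]_(v : G) degree v.

(* G is isomorphic to a (not necessarily induced) subgraph of H. *)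
Definition subgraph (G H : sgraph) : Prop :=
  exists f : G -> H, injective f /\ (forall x y : G, adj x y -> adj (f x) (f y)).

Section Induced.
Variables (G : sgraph) (A : {set G}).
Definition induced_adj : rel {x : G | x \in A} := fun x y => adj (val x) (val y).
Lemma induced_adj_sym : symmetric induced_adj.
Proof. by move=> x y; rewrite /induced_adj adj_sym. Qed.
Lemma induced_adj_irr : irreflexive induced_adj.
Proof. by move=> x; rewrite /induced_adj adj_irr. Qed.
Definition induced : sgraph := SGraph induced_adj_sym induced_adj_irr.
End Induced.

Section Complete.
Variable s : nat.
Definition complete_adj : rel 'I_s := fun x y => x != y.
Lemma complete_adj_sym : symmetric complete_adj.
Proof. by move=> x y; rewrite /complete_adj eq_sym. Qed.
Lemma complete_adj_irr : irreflexive complete_adj.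
Proof. by move=> x; rewrite /complete_adj eqxx. Qed.
Definition complete : sgraph := SGraph complete_adj_sym complete_adj_irr.
End Complete.

Section Edgeless.
Variable t : nat.
Definition edgeless_adj : rel 'I_t := fun _ _ => false.
Lemma edgeless_adj_sym : symmetric edgeless_adj. Proof. by []. Qed.
Lemma edgeless_adj_irr : irreflexive edgeless_adj. Proof. by []. Qed.
Definition edgeless : sgraph := SGraph edgeless_adj_sym edgeless_adj_irr.
End Edgeless.

Section UnionJoin.
Variables G H : sgraph.

Definition sum_adj (cross : bool) : rel (G + H)%type := fun u v =>
  match u, v with
  | inl x, inl y => adj x y
  | inr x, inr y => adj x y
  | _, _ => cross
  end.
Lemma sum_adj_sym cross : symmetric (sum_adj cross).
Proof. by move=> [x|x] [y|y] //=; rewrite adj_sym. Qed.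
Lemma sum_adj_irr cross : irreflexive (sum_adj cross).
Proof. by move=> [x|x] /=; rewrite adj_irr. Qed.

Definition disjoint_union : sgraph := SGraph (sum_adj_sym false) (sum_adj_irr false).
Definition join : sgraph := SGraph (sum_adj_sym true) (sum_adj_irr true).
End UnionJoin.

(* The size condition excludes the degenerate closed walks on at most two
   vertices that [ucycle] accepts. *)
Definition hamiltonian (G : sgraph) : Prop :=
  exists c : seq G, [/\ 2 < size c, ucycle adj c & forall x : G, x \in c].

Definition k_hamiltonian (k : nat) (G : sgraph) : Prop :=
  forall S : {set G}, #|S| <= k -> hamiltonian (induced (~: S)).

(* Natural subtraction is truncated, so H_graph n k d and L_graph n k d are the
   intended n-vertex graphs only for k < d and n large (2 * d <= n + k,
   respectively d < n); n - 2d + k is written n + k - 2 * d to truncate only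
   when the integer value is negative. *)
Definition H_graph (n k d : nat) : sgraph :=
  join (complete d) (disjoint_union (complete (n + k - 2 * d)) (edgeless (d - k))).
Definition L_graph (n k d : nat) : sgraph :=
  join (complete k.+1) (disjoint_union (complete (n - d - 1)) (complete (d - k))).

(* Main.v *)
(* Suppose [G - S] has no Hamilton cycle, with [#|S| <= k], and let [M] be an
   edge-maximal graph without Hamilton cycle on [W = V(G) \ S] that contains
   [G - S]; by Ore's argument non-adjacent vertices of [M] have degree sum less
   than [#|W|]. Put [t = delta - k].
   By Pósa's condition some [0 < i < #|W| / 2] has at least [i] vertices of degree
   at most [i]; the lower bound on the number of edges forces [i <= t], hence
   [#|S| = k] and [i = t], and gives a set [T] of [t] vertices of degree exactly
   [t] in [M]. Two non-adjacent vertices outside [T] would again cost too many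
   edges, so [B = W \ T] is a clique of [M]. By Ore's condition a vertex of [B]
   with a neighbour in [T] is adjacent to all of [T]. Let [A] be the set of these
   vertices: every vertex of [T] has [#|A|] neighbours in [A] and [t - #|A|] in [T].
   If [#|A| = t], then [T] is independent and [G] embeds in [H_{n,k,delta}] with
   [S ∪ A] as dominating clique; if [#|A| = 1], then [G] embeds in [L_{n,k,delta}].
   If [1 < #|A| < t], then for any [a] in [A] the set [T ∪ (A \ a)] carries a
   Hamilton cycle by Dirac's condition, and the rest of the clique [B] can be
   inserted in it, starting at [a]: a contradiction. *)

Require Import Defs.
From mathcomp Require Import all_boot zify.

Set Implicit Arguments.
Unset Strict Implicit.
Unset Printing Implicit Defensive.

(** * Hamilton cycles on vertex subsets: saturation, Ore's and Pósa's conditions *)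

Section HamiltonianSets.
Variable V : finType.
Implicit Types (e M : rel V) (W X : {set V}) (u v w x y : V).

Definition deg e W v := #|[set w in W | e v w]|.
Definition codeg e W v := #|[set w in W | (w != v) && ~~ e v w]|.

(** Boolean, so that Hamiltonicity can be decided by cases, and relative to a subset [W], so that
    passing to a smaller vertex set does not change the type. *)
Definition ham e W :=
  [exists c : #|W|.-tuple V,
    [&& 2 < #|W|, cycle e c & perm_eq c (enum W)]].

Lemma hamP e W :
  reflect (exists c, [/\ 2 < size c, cycle e c, uniq c & c =i W]) (ham e W).
Proof.
apply: (iffP existsP) => [[c /and3P[W2 ec pc]]|[c [c2 ec uc cW]]].
  exists c; rewrite size_tuple (perm_uniq pc) enum_uniq; split=> // x.
  by rewrite (perm_mem pc) mem_enum.
have sc : size c == #|W| by rewrite -(eq_card cW) (card_uniqP uc).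
exists (Tuple sc); apply/and3P; split=> //; first by rewrite -(eqP sc).
by apply: uniq_perm => // [|x]; rewrite ?enum_uniq // cW mem_enum.
Qed.

Lemma deg_sub e M W X v : subrel e M -> W \subset X -> deg e W v <= deg M X v.
Proof.
move=> eM WX; apply: subset_leq_card; apply/subsetP => w; rewrite !inE.
by case/andP=> /(subsetP WX) -> /eM.
Qed.

Lemma deg_codeg e W v : irreflexive e -> v \in W ->
  (deg e W v + codeg e W v).+1 = #|W|.
Proof.
move=> ei vW; rewrite (cardsD1 v W) vW add1n; congr _.+1.
rewrite -(cardsID [set w | e v w] (W :\ v)) /deg /codeg; congr (_ + _);
  apply: eq_card => w; rewrite !inE.
  case: eqP => [->|_]; first by rewrite ei andbF.
  by rewrite andbC.
by rewrite andbA andbC [(w \in W) && _]andbC.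
Qed.

(** The total over [W] counts each missing pair between [X] and [W :\: X] from both ends. Doubling
    the sum over [X] overcounts only the ordered missing pairs inside [X], of which there are at
    most [#|X| * #|X|.-1]. *)
Lemma sum_codeg_subset e W X : symmetric e -> X \subset W ->
  2 * \sum_(x in X) codeg e W x
    <= \sum_(w in W) codeg e W w + #|X| * #|X|.-1.
Proof.
move=> es XW; rewrite [\sum_(w in W) _](big_setID X) /= (setIidPr XW) mul2n -addnn -addnA leq_add2l.
have le1 x : x \in X ->
    codeg e W x <= \sum_(w in W :\: X) (~~ e x w : nat) + #|X|.-1.
  move=> xX; rewrite /codeg -(cardsID X) addnC leq_add //.
    rewrite -big_mkcondr sum1dep_card; apply: subset_leq_card; apply/subsetP => w.
    by rewrite !inE => /andP[-> /and3P[-> _ ->]].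
  rewrite (cardsD1 x X) xX; apply: subset_leq_card; apply/subsetP => w.
  by rewrite !inE => /andP[/and3P[_ -> _] ->].
apply: (leq_trans (leq_sum _ le1)); rewrite big_split /= sum_nat_const leq_add2r.
rewrite exchange_big /=; apply: leq_sum => w /setDP[wW wX].
rewrite -big_mkcondr sum1dep_card; apply: subset_leq_card; apply/subsetP => x.
rewrite !inE es => /andP[xX ->]; rewrite (subsetP XW) //= andbT.
by apply: contra wX => /eqP <-.
Qed.

Definition add_edge e u v : rel V :=
  fun x y => [|| e x y, (x == u) && (y == v) | (x == v) && (y == u)].

Lemma add_edge_sym e u v : symmetric e -> symmetric (add_edge e u v).
Proof.
move=> es x y; rewrite /add_edge es; congr (_ || _).
by rewrite orbC [(x == v) && _]andbC [(x == u) && _]andbC.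
Qed.

Lemma add_edge_irr e u v : irreflexive e -> u != v -> irreflexive (add_edge e u v).
Proof.
move=> ei uv x; rewrite /add_edge ei /=.
by case: (eqVneq x u) uv => [->|_] /= => [/negPf->|_] //; rewrite andbF.
Qed.

Definition saturated M W :=
  forall u v, u \in W -> v \in W -> u != v -> ~~ M u v -> ham (add_edge M u v) W.

(** Edges that create no Hamilton cycle are added one by one; the number of non-adjacent ordered
    pairs drops each time. *)
Lemma saturated_extension e W : symmetric e -> irreflexive e -> ~~ ham e W ->
  exists M, [/\ symmetric M, irreflexive M, subrel e M, ~~ ham M W & saturated M W].
Proof.
have [m] := ubnP #|[pred p : V * V | ~~ e p.1 p.2]|.
elim: m e => // m IH e; rewrite ltnS => le_m es ei nh.
case: (pickP [pred p : V * V | [&& p.1 \in W, p.2 \in W, p.1 != p.2,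
   ~~ e p.1 p.2 & ~~ ham (add_edge e p.1 p.2) W]]) => [[u v]|sat].
  case/and5P=> /= uW vW uv euv nh'.
  have sub : subrel e (add_edge e u v) by move=> x y exy; apply/orP; left.
  have [||||M [Ms Mi eM nhM satM]] := IH (add_edge e u v) => //.
  - apply: leq_trans le_m; apply: proper_card; apply/properP; split.
      by apply/subsetP => -[x y]; rewrite !inE /=; apply: contra => /sub.
    by exists (u, v); rewrite !inE //= /add_edge !eqxx orbT.
  - exact: add_edge_sym.
  - exact: add_edge_irr.
  by exists M; split=> // x y /sub /eM.
exists e; split=> // u v uW vW uv euv; have /= := sat (u, v).
by rewrite uW vW uv euv /= => /negbFE.
Qed.

(** Pigeonhole over the [size p] steps of the walk: some step has its head in [a] and its tail in
    [b]. *)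
Lemma crossing (a b : pred V) x p : size p < count a p + count b (belast x p) ->
  exists p1 y p2, [/\ p = p1 ++ y :: p2, a y & b (last x p1)].
Proof.
elim: p x => //= y p IH x.
have [/andP[ay bx] _|nab] := boolP (a y && b x); first by exists [::], y, p.
move=> lt_p; have [|p1 [z [p2 [-> az bz]]]] := IH y; first by move: nab lt_p; lia.
by exists (y :: p1), z, p2.
Qed.

(** The Hamilton cycle must use a step outside [M], hence the new edge; cutting the cycle there
    leaves a Hamilton path between its ends. *)
Lemma ham_path_of_add_edge M W u v : ~~ ham M W -> ham (add_edge M u v) W ->
  exists x y p, [/\ path M x p, uniq (x :: p), x :: p =i W, 1 < size p &
    last x p = y /\ ((x, y) = (u, v) \/ (x, y) = (v, u))].
Proof.
move=> nh /hamP[c [c2 ec uc cW]].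
have /allPn[y yc nMy] : ~~ all (fun y => M y (next c y)) c.
  apply: contra nh => /allP Mc; apply/hamP; exists c; split=> //.
  exact: cycle_from_next.
have := next_cycle ec yc; set x := next c y in nMy * => eyx.
have xc : x \in c by rewrite mem_next.
have yE : y = prev c x by rewrite prev_next.
have [i p cE] := rot_to xc.
have up : uniq (x :: p) by rewrite -cE rot_uniq.
have cp : cycle (add_edge M u v) (x :: p) by rewrite -cE rot_cycle.
have pW : x :: p =i W by move=> z; rewrite -cE mem_rot cW.
have sp : 1 < size p by rewrite -ltnS -/(size (x :: p)) -cE size_rot.
have lp : last x p = y.
  case/andP: up => xp _; rewrite yE -(prev_rot i uc) cE prev_nth mem_head.
  by rewrite (memNindex xp) -[size p]/(size (x :: p)).-1 nth_last.
have xy : (x, y) = (u, v) \/ (x, y) = (v, u).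
  move: eyx; rewrite /add_edge (negPf nMy) /=.
  by case/orP=> /andP[/eqP-> /eqP->]; [right | left].
exists x, y, p; split=> //.
(* The path does not use the new edge [xy] again: its first step goes from [x] to some [z != y], and
   all later steps avoid [x]. *)
have {}cp : path (add_edge M u v) x p by move: cp; rewrite /= rcons_path => /andP[].
case: p lp sp up cp {cE pW} => [|z [|z' q]] //= lp _ /andP[xp /andP[zq uq]] /andP[xz zp].
have zy : z != y by rewrite -lp; apply: contra zq => /eqP->; exact: mem_last.
have xz' : x != z by apply: contra xp => /eqP->; rewrite mem_head.
have stepM a b : a \in [pred a | a != x] -> b \in [pred b | b != x] ->
    add_edge M u v a b -> M a b.
  rewrite !inE => ax bx /or3P[//||] /andP[/eqP ea /eqP eb];
  by case: xy => -[ex ey]; move: ax bx; rewrite ea eb ex eqxx.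
apply/andP; split.
  case/or3P: xz => [//||] /andP[/eqP ex /eqP ez];
  by case: xy => -[ex' ey']; move: zy xz'; rewrite ez ex' ey' eqxx.
have := @sub_in_path _ [pred a | a != x] _ M stepM z (z' :: q); apply=> //.
apply/allP => b bq; rewrite inE; apply: contra xp => /eqP <-.
exact: bq.
Qed.

Lemma deg_count e W s v : uniq s -> s =i W -> deg e W v = count (e v) s.
Proof.
move=> us sW; rewrite -size_filter -(card_uniqP (filter_uniq _ us)).
by apply: eq_card => w; rewrite inE mem_filter sW andbC.
Qed.

(* An edge [x z] together with an edge from [y] to the predecessor of [z] on a
   Hamilton path from [x] to [y] closes up to a Hamilton cycle; degree counting
   provides such a [z]. *)
Lemma saturated_ore M W u v : symmetric M -> irreflexive M -> ~~ ham M W ->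
  saturated M W -> u \in W -> v \in W -> u != v -> ~~ M u v ->
  deg M W u + deg M W v < #|W|.
Proof.
move=> Ms Mi nh sat uW vW uv Muv.
have [x [y [p [xp up pW sp [lp xy]]]]] := ham_path_of_add_edge nh (sat u v uW vW uv Muv).
have -> : deg M W u + deg M W v = deg M W x + deg M W y.
  by case: xy => -[-> ->]; rewrite // addnC.
have cW : #|W| = (size p).+1 by rewrite -(eq_card pW) (card_uniqP up).
have -> : deg M W x = count (M x) p by rewrite (deg_count M x up pW) /= Mi.
have -> : deg M W y = count (M y) (belast x p).
  by rewrite (deg_count M y up pW) lastI lp -cats1 count_cat /= Mi !addn0.
rewrite cW ltnS leqNgt; apply: contra nh.
case/crossing=> p1 [z [p2 [pE Mxz Myl]]].
apply/hamP; exists (x :: p1 ++ rev (z :: p2)).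
have perm : perm_eq (x :: p1 ++ rev (z :: p2)) (x :: p).
  by rewrite perm_cons pE perm_cat2l perm_rev.
split.
- by rewrite (perm_size perm) /=; lia.
- move: xp; rewrite pE cat_path => /andP[xp1 /= /andP[_ zp2]].
  rewrite /= rcons_cat cat_path xp1 /=.
  have zy : last z p2 = y by rewrite -lp pE last_cat.
  rewrite lastI zy rev_rcons /= Ms Myl /= rcons_path.
  have -> : last y (rev (belast z p2)) = z.
    by case: (p2) zy => //= b q _; rewrite rev_cons last_rcons.
  rewrite Ms Mxz andbT -zy rev_path.
  by rewrite (@eq_path _ _ M) // => a b; exact: Ms.
- by rewrite (perm_uniq perm).
- by move=> b; rewrite (perm_mem perm) pW.
Qed.

Lemma clique_path e x p : uniq (x :: p) ->
  {in x :: p &, forall y z, y != z -> e y z} -> path e x p.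
Proof.
elim: p x => //= y p IH x /and3P[xp yp up] cl; apply/andP; split.
  apply: cl; rewrite ?inE ?eqxx ?orbT //.
  by apply: contra xp => /eqP->; rewrite mem_head.
apply: IH; first by rewrite /= yp.
by move=> a b ap bp; apply: cl; rewrite inE ?ap ?bp orbT.
Qed.

Lemma clique_ham e W : 2 < #|W| -> {in W &, forall x y, x != y -> e x y} -> ham e W.
Proof.
move=> W2 cl; apply/hamP; exists (enum W); rewrite enum_uniq -cardE.
split=> // [|x]; last by rewrite mem_enum.
have := enum_uniq W; have: {subset enum W <= W} by move=> x; rewrite mem_enum.
case E: (enum W) => [|x p] //= sW; have W1 : 1 < size (x :: p) by rewrite -E -cardE ltnW.
rewrite -/(uniq (x :: p)) => up; rewrite rcons_path clique_path //=; last first.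
  by move=> a b ap bp; apply: cl; apply: sW.
apply: cl; [|by apply: sW; rewrite mem_head|].
  by apply: sW; rewrite mem_last.
case: p W1 up {E sW} => // y p _ /= /andP[+ _]; apply: contra => /eqP <-.
exact: mem_last.
Qed.

(** In a saturated extension take a non-adjacent pair [u], [v] of maximal degree sum with [u] of
    smaller degree, and let [i] be the degree of [u]. By maximality every non-neighbour of [v] has
    degree at most [i], and by Ore's bound [v] has at least [i] of them. *)
Lemma posa e W : symmetric e -> irreflexive e -> 2 < #|W| -> ~~ ham e W ->
  exists i, [/\ 0 < i, 2 * i < #|W| & i <= #|[set v in W | deg e W v <= i]|].
Proof.
move=> es ei W2 /(saturated_extension es ei)[M [Ms Mi eM nh sat]].
suff [i [i0 iW iM]] : exists i, [/\ 0 < i, 2 * i < #|W| &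
    i <= #|[set v in W | deg M W v <= i]|].
  exists i; split=> //; apply: leq_trans iM _; apply: subset_leq_card.
  apply/subsetP => v; rewrite !inE => /andP[-> /=]; apply: leq_trans.
  exact: deg_sub.
pose P := [pred p : V * V | [&& p.1 \in W, p.2 \in W, p.1 != p.2 & ~~ M p.1 p.2]].
have [p0 Pp0|noP] := pickP P; last first.
  case/negP: nh; apply: clique_ham => // x y xW yW xy.
  by have /= := noP (x, y); rewrite xW yW xy /= => /negbFE.
pose f (p : V * V) := deg M W p.1 + deg M W p.2.
have [[u v] /and4P[/= uW vW uv Muv] umax] := @arg_maxnP _ p0 P f Pp0.
wlog le_uv : u v uW vW uv Muv umax / deg M W u <= deg M W v.
  move=> wl; have [/wl|/ltnW] := leqP (deg M W u) (deg M W v); first exact.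
  apply: wl; rewrite // 1?eq_sym 1?Ms // => q /umax; rewrite /f /=; lia.
have ore := saturated_ore Ms Mi nh sat uW vW uv Muv.
have [du0|du0] := posnP (deg M W u).
  (* As [i] must be positive, an isolated [u] is used with [i = 1]. *)
  exists 1; split=> //; rewrite (cardsD1 u) inE uW du0; lia.
exists (deg M W u); split=> //; first lia.
apply: (@leq_trans (codeg M W v)); first by have := deg_codeg Mi vW; lia.
apply: subset_leq_card; apply/subsetP => w; rewrite !inE => /and3P[wW wv Mvw].
have /= := umax (w, v); rewrite wW vW wv Ms Mvw => /(_ isT).
by rewrite /f /= leq_add2r.
Qed.

End HamiltonianSets.

(** * Arithmetic of missing edges *)

(** With [r = t.+1], the bound [r * (2 * N - 3 * r - 1)] is twice the number of edges missing from
    $H_{N,0,r}$. If [du + dv < N], then [cu + cv >= N - 1], and the last hypothesis makes [s] exceed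
    the bound by at least [2 * t]. *)
Lemma codeg_bound_clique N t s cu cv du dv : s < t.+1 * (2 * N - 3 * t.+1 - 1) ->
  6 * t.+1 <= N -> (du + cu).+1 = N -> (dv + cv).+1 = N ->
  2 * (cu + (cv + t * (N - 1 - t))) <= s + (1 + (1 + t)) * (1 + (1 + t)).-1 ->
  N <= du + dv.
Proof.
move=> lt_s tN Eu Ev le_s; rewrite leqNgt; apply/negP => lt_d.
have lower : N <= (cu + cv).+1 by lia.
clear Eu Ev lt_d; have [q qE] : exists q, N = 6 * t.+1 + q by exists (N - 6 * t.+1); lia.
subst N; move: lt_s le_s.
have -> : 2 * (6 * t.+1 + q) - 3 * t.+1 - 1 = 9 * t + 8 + 2 * q by lia.
have -> : 6 * t.+1 + q - 1 - t = 5 * t + 5 + q by lia.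
clear tN; move: lower; nia.
Qed.

(** For f(i) = i(2N - 3i - 1) the hypotheses give f(i) <= s < f(r). But f(i) - f(r) = (i - r)(2N - 1
    - 3(i + r)), whose second factor, [c] below, is non-negative for r <= i < N/2 and 6r <= N. *)
Lemma codeg_bound_low N r i s : s < r * (2 * N - 3 * r - 1) -> 6 * r <= N ->
  2 * i < N -> 2 * (i * (N - 1 - i)) <= s + i * i.-1 -> i < r.
Proof.
move=> lt_s rN iN le_s; rewrite ltnNge; apply/negP => le_ri.
have [j ij] : exists j, i = r + j by exists (i - r); lia.
have [c cE] : exists c, 2 * N = 3 * (i + r) + 1 + c.
  by exists (2 * N - (3 * (i + r) + 1)); lia.
have [q qE] : exists q, N = 2 * i + 1 + q by exists (N - (2 * i + 1)); lia.
move: lt_s le_s.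
have -> : 2 * N - 3 * r - 1 = 3 * i + c by lia.
have -> : N - 1 - i = i + q by lia.
clear rN iN; move: cE; rewrite qE => cE; clear qE; nia.
Qed.

(** * Structure of dense saturated graphs without Hamilton cycle *)

Section Structure.
Variable V : finType.
Implicit Types (e M : rel V) (W X T A U R : {set V}) (u v w x y : V).

(** The cycle on [U] is cut just before [x]. Its last vertex, whichever it is, is adjacent to [a];
    from [a] the clique [R] is traversed, and its last vertex is adjacent to [x]. *)
Lemma ham_insert_clique e U R x a : symmetric e -> ham e U -> [disjoint U & R] ->
  x \in U -> a \in R -> {in R, forall y, e x y} -> {in U, forall y, e a y} ->
  {in R &, forall y z, y != z -> e y z} -> ham e (U :|: R).
Proof.
move=> es /hamP[c [c2 ec uc cU]] dis xU aR ex ea cl.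
have [i p cE] : rot_to_spec c x by apply: rot_to; rewrite cU.
have up : uniq (x :: p) by rewrite -cE rot_uniq.
have pU : x :: p =i U by move=> z; rewrite -cE mem_rot cU.
have rR : a :: enum (R :\ a) =i R.
  move=> z; rewrite inE mem_enum !inE.
  by case: eqP => [->|].
have ur : uniq (a :: enum (R :\ a)) by rewrite /= mem_enum !inE eqxx enum_uniq.
have : path e x p by move: ec; rewrite -(rot_cycle i) cE /= rcons_path => /andP[].
apply: contraTT => /hamP nh; apply/negP => xp; apply: nh.
exists ((x :: p) ++ a :: enum (R :\ a)); split.
- move: c2; rewrite -(size_rot i) cE size_cat /=; lia.
- rewrite /= rcons_cat cat_path xp /= rcons_path es ea -?pU ?mem_last //=.
  rewrite clique_path //=; last by move=> y z; rewrite !rR; exact: cl.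
  by rewrite es ex // -rR mem_last.
- rewrite cat_uniq up ur andbT; apply/hasPn => z; rewrite rR => zR.
  by rewrite /= pU (disjointFl dis).
- by move=> z; rewrite mem_cat rR pU inE.
Qed.

Lemma dense_low_degree e W r : symmetric e -> irreflexive e -> 2 < #|W| ->
  6 * r <= #|W| -> ~~ ham e W ->
  \sum_(v in W) codeg e W v < r * (2 * #|W| - 3 * r - 1) ->
  exists T, [/\ T \subset W, 0 < #|T| < r & {in T, forall v, deg e W v <= #|T|}].
Proof.
move=> es ei W2 rW nh lt_sum.
have [i [i0 iW]] := posa es ei W2 nh.
case/card_geqP=> s [us ss sP].
have sT : #|[set v in s]| = i by rewrite cardsE (card_uniqP us).
have TW : [set v in s] \subset W.
  by apply/subsetP => v; rewrite inE => /sP; rewrite inE => /andP[].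
have low : {in [set v in s], forall v, deg e W v <= i}.
  by move=> v; rewrite inE => /sP; rewrite inE => /andP[].
exists [set v in s]; rewrite sT i0; split=> //.
have le_sum := sum_codeg_subset es TW; rewrite sT in le_sum.
apply: (codeg_bound_low lt_sum rW iW); apply: leq_trans le_sum.
rewrite leq_mul2l -{1}sT -sum_nat_const /=; apply: leq_sum => v vT.
have := deg_codeg ei (subsetP TW v vT); have := low v vT.
move: (deg _ _ _) (codeg _ _ _) => a b; clear; lia.
Qed.

Lemma dense_saturated_structure M W t : symmetric M -> irreflexive M ->
  0 < t -> 2 < #|W| -> 6 * t.+1 <= #|W| -> ~~ ham M W -> saturated M W ->
  {in W, forall v, t <= deg M W v} ->
  \sum_(v in W) codeg M W v < t.+1 * (2 * #|W| - 3 * t.+1 - 1) ->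
  exists T A, [/\ [/\ T \subset W, A \subset W, [disjoint T & A] & #|T| = t],
    {in T, forall x, deg M W x = t},
    {in T & W, forall x y, M x y -> y \in T :|: A} &
    #|A| = 1 \/ (#|A| = t /\ {in T &, forall x y, ~~ M x y})].
Proof.
move=> Ms Mi t0 W2 tW nh sat mind lt_sum.
have [T [TW /andP[T0 Tt] low]] := dense_low_degree Ms Mi W2 tW nh lt_sum.
have {T0 Tt}cT : #|T| = t.
  case/card_gt0P: T0 => v vT; have := low v vT; have := mind v (subsetP TW v vT); lia.
have {low}degT : {in T, forall x, deg M W x = t}.
  by move=> x xT; have := low x xT; have := mind x (subsetP TW x xT); lia.
have ore := saturated_ore Ms Mi nh sat.
set B := W :\: T.
have BW : {subset B <= W} by move=> x /setDP[].
have cW : #|W| = #|B| + t.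
  by rewrite /B cardsD (setIidPr TW) cT subnK // -cT subset_leq_card.
(* A missing pair [u], [v] in [B] has degree sum below [#|W|]; counting missing edges at [u], [v]
   and all of [T] then contradicts [lt_sum]. *)
have clB : {in B &, forall x y, x != y -> M x y}.
  move=> u v uB vB uv; apply/idPn => Muv.
  have := ore u v (BW u uB) (BW v vB) uv Muv; rewrite ltnNge => /negP; apply.
  have uT : u \notin T by case/setDP: uB.
  have vT : v \notin T by case/setDP: vB.
  have uvT : u \notin v |: T by rewrite !inE negb_or uv.
  have XW : u |: (v |: T) \subset W.
    apply/subsetP => x; rewrite !inE => /or3P[/eqP->|/eqP->|]; try exact: BW.
    exact: (subsetP TW).
  have := sum_codeg_subset Ms XW.
  rewrite !cardsU1 uvT vT cT big_setU1 //= big_setU1 //=.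
  have -> : \sum_(x in T) codeg M W x = t * (#|W| - 1 - t).
    rewrite -cT -sum_nat_const; apply: eq_bigr => x xT.
    by rewrite -(deg_codeg Mi (subsetP TW x xT)) degT // cT subSS subn0 addKn.
  apply: (codeg_bound_clique lt_sum tW); exact: deg_codeg Mi (BW _ _).
pose A := [set y in B | [exists x in T, M x y]].
have AB : {subset A <= B} by move=> y; rewrite inE => /andP[].
have joinA : {in T & A, forall x y, M x y}.
  move=> x y xT; rewrite inE => /andP[yB /existsP[x' /andP[x'T Mx'y]]].
  apply/idPn => Mxy.
  have xy : x != y by apply: contraTneq xT => ->; case/setDP: yB.
  have := ore x y (subsetP TW x xT) (BW y yB) xy Mxy.
  (* Besides the other vertices of [B], [y] sees [x'] in [T], so its degree is at least [#|B|], too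
     large for Ore's bound with [x]. *)
  rewrite degT // cW [t + _]addnC; suff leB : #|B| <= deg M W y by rewrite ltnNge leq_add2r leB.
  rewrite (cardsD1 y B) yB; have <- : #|x' |: B :\ y| = 1 + #|B :\ y|.
    by rewrite cardsU1 !inE x'T /= andbF.
  apply: subset_leq_card; apply/subsetP => z; rewrite !inE.
  case/predU1P => [->|/and3P[zy zT zW]]; first by rewrite (subsetP TW) // Ms.
  by rewrite zW clB // 1?eq_sym // !inE zT.
have TA : [disjoint T & A].
  rewrite disjoint_sym; apply/pred0P => y /=; apply/negP => /andP[/AB].
  by rewrite inE => /andP[/negPf->].
have nbT : {in T & W, forall x y, M x y -> y \in T :|: A}.
  move=> x y xT yW Mxy; rewrite !inE yW /=; case: (boolP (y \in T)) => //= _.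
  by apply/existsP; exists x; rewrite xT.
exists T, A; split=> //.
  by split=> //; apply/subsetP => y /AB /BW.
have AN x : x \in T -> A \subset [set w in W | M x w].
  by move=> xT; apply/subsetP => y yA; rewrite inE (BW y (AB y yA)) joinA.
have [x0 x0T] : exists x, x \in T by apply/card_gt0P; rewrite cT.
have leAt : #|A| <= t by rewrite -(degT x0 x0T); apply/subset_leq_card/AN.
have [eqAt|neAt] := eqVneq #|A| t.
  right; split=> // x y xT yT; apply/negP => Mxy.
  have : y \in [set w in W | M x w] by rewrite inE (subsetP TW).
  (* [A] already exhausts the [t] neighbours of [x], leaving none in [T]. *)
  have /eqP <- : A == [set w in W | M x w].
    by rewrite eqEcard AN //= eqAt -(degT x xT).
  by rewrite (disjointFr TA).
have A0 : 0 < #|A|.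
  have : deg M W x0 <= #|(T :\ x0) :|: A|.
    apply: subset_leq_card; apply/subsetP => y; rewrite inE => /andP[yW Mxy].
    move: (nbT x0 y x0T yW Mxy); rewrite in_setU in_setU in_setD1.
    by case: eqP => // e; rewrite e Mi in Mxy.
  have := cardsD1 x0 T; rewrite x0T cT degT // => cT'.
  by rewrite cardsU; move: cT'; clear; lia.
have [A1|A1] := leqP #|A| 1; first by left; lia.
(* [t + #|A|.-1] is the size of the set [U] below, on which all degrees turn out to be at least
   [t.-1]; since [#|A| < t], this is at least half of [#|U|]. *)
have [U2 dense] : 2 < t + #|A|.-1 /\ forall i, t.-1 <= i -> t + #|A|.-1 <= 2 * i.
  by move: A1 leAt neAt; move: #|A|; clear; split; lia.
case/negP: nh.
case/card_gt0P: A0 => a aA.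
pose U := T :|: A :\ a.
have cU : #|U| = t + #|A|.-1.
  have dis : [disjoint T & A :\ a] by apply: disjointWr TA; exact: subsetDl.
  by rewrite cardsU cT (disjoint_setI0 dis) cards0 subn0 (cardsD1 a A) aA.
have UW : U \subset W.
  apply/subsetP => y; rewrite inE => /orP[/(subsetP TW)//|/setD1P[_ /AB /BW //]].
have aU : a \notin U by rewrite !inE eqxx orbF (disjointFl TA).
have [x /setD1P[xa xA]] : exists x, x \in A :\ a.
  by apply/card_gt0P; move: A1; rewrite (cardsD1 a A) aA; lia.
have DB : {subset W :\: U <= B}.
  by move=> y; rewrite !inE negb_or => /andP[/andP[-> _] ->].
have WE : U :|: W :\: U = W by rewrite -[RHS](setID W U) (setIidPr UW).
have xU : x \in U by rewrite in_setU in_setD1 xa xA orbT.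
have xB : x \in B by apply: AB.
have aD : a \in W :\: U by rewrite in_setD aU BW // AB.
rewrite -WE; apply: (@ham_insert_clique M U (W :\: U) x a) => //.
- apply: contraT => nhU.
  have [|i [i0 iU]] := posa Ms Mi _ nhU; first by rewrite cU.
  move=> /(leq_trans i0)/card_gt0P[v]; rewrite inE => /andP[vU le_i].
  suff /leq_trans/(_ le_i)/dense : t.-1 <= deg M U v by rewrite -cU leqNgt iU.
  (* A vertex of [T] loses at most the neighbour [a]; a vertex of [A] keeps all of [T]. *)
  move: vU; rewrite in_setU in_setD1 => /orP[vT|/andP[_ vA]].
    rewrite -(degT v vT) /deg (cardsD1 a); rewrite -subn1 leq_subLR.
    apply: leq_add; first exact: leq_b1.
    apply: subset_leq_card; apply/subsetP => y.
    rewrite in_setD1 in_set => /and3P[ya yW Mvy]; rewrite in_set Mvy andbT.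
    by move: (nbT v y vT yW Mvy); rewrite !in_setU in_setD1 ya.
  apply: leq_trans (_ : #|T| <= _); first by rewrite cT leq_pred.
  apply: subset_leq_card; apply/subsetP => y yT.
  by rewrite in_set in_setU yT Ms joinA.
- by rewrite -setI_eq0 setIDA setDIl setDv set0I.
- move=> y yD; apply: clB => //; first exact: DB.
  by apply: contraTneq yD => <-; rewrite in_setD xU.
- move=> y; rewrite in_setU in_setD1 => /orP[yT|/andP[ya yA]].
    by rewrite Ms joinA.
  by apply: clB; rewrite 1?eq_sym //; apply: AB.
- by move=> y z yD zD; apply: clB; apply: DB.
Qed.
End Structure.

(** * Edge counts and missing pairs *)

Lemma handshake (G : sgraph) : \sum_(v : G) degree v = 2 * num_edges G.
Proof.
have -> : \sum_(v : G) degree v = \sum_(v : G) #|[set E in edges G | v \in E]|.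
  apply: eq_bigr => v _; rewrite /degree.
  rewrite -(card_in_imset (f := fun w => [set v; w]) (D := mem [set w | adj v w])); last first.
    move=> w w'; rewrite !inE => vw vw' /setP/(_ w); rewrite !inE eqxx orbT.
    by case: eqP => [wv|_ /esym/eqP //]; rewrite wv adj_irr in vw.
  apply: eq_card => E; rewrite !inE; apply/imsetP/andP.
    case=> w; rewrite inE => vw ->; rewrite !inE eqxx; split=> //.
    by apply/existsP; exists v; apply/existsP; exists w; rewrite vw eqxx.
  case=> /existsP[x /existsP[y /andP[xy /eqP->]]].
  rewrite !inE => /orP[]/eqP ->; [exists y | exists x]; rewrite ?inE //.
    by rewrite adj_sym.
  by rewrite setUC.
transitivity (\sum_(E in edges G) #|E|); last first.
  rewrite mulnC -sum_nat_const; apply: eq_bigr => E.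
  rewrite inE => /existsP[x /existsP[y /andP[xy /eqP->]]]; rewrite cards2.
  by case: eqP xy => // ->; rewrite adj_irr.
transitivity (\sum_(v : G) \sum_(E in edges G) (v \in E : nat)).
  apply: eq_bigr => v _; rewrite -big_mkcondr sum1dep_card.
  by apply: eq_card => E; rewrite !inE.
rewrite exchange_big /=; apply: eq_bigr => E _.
by rewrite -big_mkcond /= sum1_card.
Qed.

Lemma num_edges_codeg (G : sgraph) :
  2 * num_edges G + \sum_(v : G) codeg adj [set: G] v = #|G| * #|G|.-1.
Proof.
rewrite -handshake -big_split /= -sum_nat_const; apply: eq_bigr => v _.
have := deg_codeg (@adj_irr G) (in_setT v); rewrite cardsT => <-.
by rewrite /= /deg /degree; congr (_ + _); apply: eq_card => w; rewrite !inE.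
Qed.

(** * Embeddings into three-part joins *)

(** Both target graphs have this shape: 0 marks the dominating clique, 1 the large clique, 2 the
    small part. *)
Definition join_class (K P Q : finType) (z : K + (P + Q)) : nat :=
  match z with inl _ => 0 | inr (inl _) => 1 | inr (inr _) => 2 end.

Lemma card_join_class (K P Q : finType) j :
  #|[set z : K + (P + Q) | join_class z == j]| = nth 0 [:: #|K|; #|P|; #|Q|] j.
Proof.
rewrite -sum1dep_card big_mkcond big_sumType /= big_sumType /= !sum_nat_const.
by case: j => [|[|[|j]]] /=; rewrite ?muln1 ?muln0 ?addn0 ?nth_nil.
Qed.

(** The j-th element of a class goes to the j-th element of the class with the same label; by the
    size hypothesis the default [z0] of [nth] is never reached. *)
Lemma class_embedding (V Z : finType) (I : eqType) (c : V -> I) (d : Z -> I) (z0 : Z) :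
  (forall i, #|[set x | c x == i]| <= #|[set z | d z == i]|) ->
  exists f : V -> Z, injective f /\ forall x, d (f x) = c x.
Proof.
move=> le_cd.
pose s i := enum [set z | d z == i]; pose r i := enum [set x | c x == i].
have in_r x : x \in r (c x) by rewrite mem_enum inE.
have lt_s x : index x (r (c x)) < size (s (c x)).
  by rewrite -cardE; apply: leq_trans (le_cd _); rewrite cardE index_mem in_r.
exists (fun x => nth z0 (s (c x)) (index x (r (c x)))).
have df x : d (nth z0 (s (c x)) (index x (r (c x)))) = c x.
  by have := mem_nth z0 (lt_s x); rewrite mem_enum inE => /eqP.
split=> // x y fxy; have cxy : c x = c y by rewrite -df fxy df.
move/eqP: fxy; rewrite cxy nth_uniq ?enum_uniq //; last by rewrite -cxy.
by move/eqP=> exy; rewrite -(nth_index x (in_r x)) cxy exy nth_index ?in_r.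
Qed.

Definition part_class (V : finType) (P T : {set V}) (x : V) :=
  if x \in P then 0 else if x \in T then 2 else 1.

Lemma join_embedding (V K Q R : finType) (P T : {set V}) :
  0 < #|K| -> [disjoint P & T] -> #|P| = #|K| -> #|T| = #|R| ->
  #|V| = #|K| + #|Q| + #|R| ->
  exists f : V -> K + (Q + R), injective f /\
    forall x, join_class (f x) = part_class P T x.
Proof.
case/card_gt0P=> k0 _ dis cP cT cV.
apply: class_embedding => [|j]; first by left.
rewrite card_join_class.
case: j => [|[|[|j]]] /=.
- rewrite -cP; apply: subset_leq_card; apply/subsetP => x; rewrite inE /part_class.
  by case: ifP => //; case: ifP.
- have -> : #|Q| = #|~: (P :|: T)|.
    have := cardsC (P :|: T); rewrite cardsU (disjoint_setI0 dis) cards0; lia.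
  apply: subset_leq_card; apply/subsetP => x; rewrite !inE /part_class.
  by case: ifP => //; case: ifP.
- rewrite -cT; apply: subset_leq_card; apply/subsetP => x; rewrite inE /part_class.
  by case: ifP => //; case: ifP.
rewrite nth_nil leqn0 cards_eq0; apply/eqP/setP => x; rewrite !inE /part_class.
by case: ifP => //; case: ifP.
Qed.

(** Distinct vertices of [H_graph] are non-adjacent only for the label pairs 1-2 and 2-2, and [adjT]
    keeps edges of [G] away from both. For [L_graph] only 1-2 is to be avoided. *)
Lemma subgraph_H (G : sgraph) k d (P T : {set G}) : k < d ->
  [disjoint P & T] -> #|P| = d -> #|T| = d - k -> 2 * d <= #|G| + k ->
  (forall x y, adj x y -> x \in T -> y \in P) -> subgraph G (H_graph #|G| k d).
Proof.
move=> kd dis cP cT dG adjT.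
have [||||f [fi fc]] := @join_embedding G 'I_d 'I_(#|G| + k - 2 * d) 'I_(d - k) P T _ dis.
- by rewrite card_ord; lia.
- by rewrite card_ord.
- by rewrite card_ord.
- by rewrite !card_ord; lia.
exists f; split=> // x y xy.
have : f x != f y by rewrite (inj_eq fi); apply: contraTneq xy => ->; rewrite adj_irr.
have := fc x; have := fc y; rewrite /part_class.
have := adjT x y xy; have := adjT y x; rewrite adj_sym xy => /(_ isT).
case: (f x) => [x'|[x'|x']]; case: (f y) => [y'|[y'|y']] //=;
  case: (x \in P) => //; case: (y \in P) => //;
  case: (x \in T) => //; case: (y \in T) => //.
all: by move=> yT xT; first [by have := yT isT | by have := xT isT].
Qed.

Lemma subgraph_L (G : sgraph) k d (P T : {set G}) : k < d ->
  [disjoint P & T] -> #|P| = k.+1 -> #|T| = d - k -> d < #|G| ->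
  (forall x y, adj x y -> x \in T -> y \in T :|: P) -> subgraph G (L_graph #|G| k d).
Proof.
move=> kd dis cP cT dG adjT.
have [||||f [fi fc]] := @join_embedding G 'I_k.+1 'I_(#|G| - d - 1) 'I_(d - k) P T _ dis.
- by rewrite card_ord; lia.
- by rewrite card_ord.
- by rewrite card_ord.
- by rewrite !card_ord; lia.
exists f; split=> // x y xy.
have : f x != f y by rewrite (inj_eq fi); apply: contraTneq xy => ->; rewrite adj_irr.
have := fc x; have := fc y; rewrite /part_class.
have := adjT x y xy; have := adjT y x; rewrite adj_sym xy => /(_ isT); rewrite !in_setU.
case: (f x) => [x'|[x'|x']]; case: (f y) => [y'|[y'|y']] //=;
  case: (x \in P) => //; case: (y \in P) => //;
  case: (x \in T) => //; case: (y \in T) => //.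
all: by move=> yT xT; first [by have := yT isT | by have := xT isT].
Qed.

(** * Order and missing edges of [H_graph] *)

Lemma card_H n k d : k < d -> 2 * d <= n + k -> #|H_graph n k d| = n.
Proof. by move=> kd dn; rewrite !card_sum !card_ord; lia. Qed.

(** An upper bound suffices, since it bounds the number of edges of [H_graph] from below. The two
    summands come from the large clique and the independent part. *)
Lemma sum_codeg_H n k d : \sum_(z : H_graph n k d) codeg adj [set: H_graph n k d] z
    <= (n + k - 2 * d) * (d - k) + (d - k) * (n + k - 2 * d + (d - k).-1).
Proof.
set H := H_graph n k d; set m := n + k - 2 * d; set r := d - k.
have cC j : #|[set w : H | join_class w == j]| = nth 0 [:: d; m; r] j.
  by rewrite card_join_class !card_ord.
have cH : #|[set: H]| = d + (m + r) by rewrite cardsT !card_sum !card_ord.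
rewrite big_sumType big_sumType /= big1 ?add0n => [|x _].
  apply: leq_add.
    apply: leq_trans (_ : \sum_(x : 'I_m) r <= _); last by rewrite sum_nat_const card_ord.
    apply: leq_sum => x _; rewrite -[r]/(nth 0 [:: d; m; r] 2) -cC.
    apply: subset_leq_card; apply/subsetP => -[w|[w|w]]; rewrite !inE //=.
    by rewrite /complete_adj negbK; case: (x =P w) => [->|_]; rewrite ?eqxx ?andbF.
  apply: leq_trans (_ : \sum_(x : 'I_r) (m + r.-1) <= _).
    apply: leq_sum => x _; set z : H := inr (inr x).
    have le_d : d <= deg adj [set: H] z.
      rewrite -[d in d <= _]/(nth 0 [:: d; m; r] 0) -cC; apply: subset_leq_card.
      by apply/subsetP => -[w|[w|w]]; rewrite !inE.
    have := deg_codeg (@adj_irr H) (in_setT z); rewrite cH.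
    move: (deg _ _ _) (codeg _ _ _) le_d (ltn_ord x) => a b; clear; lia.
  by rewrite sum_nat_const card_ord.
rewrite /codeg; apply/eqP; rewrite cards_eq0; apply/eqP/setP => -[w|[w|w]]; rewrite !inE //=.
by rewrite /complete_adj negbK; case: (x =P w) => [->|_]; rewrite ?eqxx ?andbF.
Qed.

(** * Return to induced subgraphs, and the theorem *)

Lemma hamiltonian_induced (G : sgraph) (W : {set G}) :
  ham adj W -> hamiltonian (induced W).
Proof.
case/hamP=> c [c2 ec uc cW].
have cE : map val (pmap (insub : G -> option (induced W)) c) = c.
  rewrite (pmap_filter (insubK _)); apply/all_filterP/allP => x; rewrite cW => xW.
  by rewrite /= insubT.
exists (pmap insub c); split.
- by rewrite -(size_map val) cE.
- apply/andP; split; last by rewrite -(map_inj_uniq val_inj) cE.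
  by move: ec; rewrite -{1}cE; case: (pmap _ c) => //= x p; rewrite -map_rcons path_map.
- by move=> x; rewrite -(mem_map val_inj) cE cW (valP x).
Qed.

Lemma min_degree_le (G : sgraph) (v : G) : min_degree G <= degree v.
Proof.
rewrite /min_degree; have := mem_index_enum v; elim: (index_enum _) => // u s IH.
rewrite big_cons inE => /predU1P[<-|/IH]; first exact: geq_minl.
exact: leq_trans (geq_minr _ _).
Qed.

Theorem theorem3p6 (k delta : nat) (hk : k < delta) :
  exists n0 : nat, forall (n : nat) (G : sgraph),
    n0 <= n -> #|G| = n -> delta <= min_degree G ->
    num_edges (H_graph n k delta.+1) < num_edges G ->
    k_hamiltonian k G \/
    subgraph G (H_graph n k delta) \/ subgraph G (L_graph n k delta).
Proof.
(* A generous linear bound: it yields [6 * t.+1 <= #|W|] and [k + 4 * t.+1 <= n] for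
   [t = delta - k]. *)
exists (10 * delta.+2) => n G n_large cG mindeg many_edges.
have [/forallP hamk|] := boolP [forall S : {set G}, (#|S| <= k) ==> ham adj (~: S)].
  by left=> S Sk; apply: hamiltonian_induced; apply: (implyP (hamk S)).
case/forallPn=> S; rewrite negb_imply => /andP[Sk nonham]; right.
pose W := ~: S; pose t := delta - k.
have cSW : #|S| + #|W| = n by rewrite -cG cardsC.
have [M [Ms Mi eM nh sat]] := saturated_extension (@adj_sym G) (@adj_irr G) nonham.
have minM : {in W, forall v, delta - #|S| <= deg M W v}.
  move=> v vW; rewrite leq_subLR; apply: leq_trans mindeg _.
  apply: leq_trans (min_degree_le v) _; rewrite /degree -(cardsID S) leq_add //.
    by apply: subset_leq_card; apply: subsetIr.
  by apply: subset_leq_card; apply/subsetP => w; rewrite !inE => /andP[-> /eM].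
(* Deleting [k] dominating vertices from $H_{n,k,\delta+1}$ leaves $H_{n-k,0,t+1}$ with the same
   missing pairs, so the bound is exact for [#|S| = k]; a smaller [S] only enlarges the right-hand
   side. *)
have few : \sum_(v in W) codeg M W v < t.+1 * (2 * #|W| - 3 * t.+1 - 1).
  have le_codeg : \sum_(v in W) codeg M W v <= \sum_(v : G) codeg adj [set: G] v.
    rewrite [X in _ <= X](bigID (mem W)) /=; apply: leq_trans (leq_addr _ _).
    apply: leq_sum => v _; apply: subset_leq_card; apply/subsetP => w.
    by rewrite !inE => /and3P[_ -> /=]; apply: contra => /eM.
  apply: leq_ltn_trans le_codeg _.
  have := num_edges_codeg G; have := num_edges_codeg (H_graph n k delta.+1).
  have := sum_codeg_H n k delta.+1.
  rewrite card_H ?cG; [|lia|lia].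
  move: (\sum_(_ : G) _) (\sum_(_ : H_graph _ _ _) _) many_edges => a b.
  move: (num_edges _) (num_edges _) (n * _) => x y z xy.
  have -> : delta.+1 - k = t.+1 by rewrite /t; lia.
  have [q qE] : exists q, n = k + 4 * t.+1 + q by exists (n - (k + 4 * t.+1)); rewrite /t; lia.
  have [p pE] : exists p, k = #|S| + p by exists (k - #|S|); lia.
  have -> : n + k - 2 * delta.+1 = 2 * t.+1 + q by move: qE; rewrite /t; lia.
  have -> : 2 * #|W| - 3 * t.+1 - 1 = 5 * t + 4 + 2 * q + 2 * p by move: qE; rewrite /t; lia.
  move: xy; clear; rewrite /= => xy; nia.
have [||||T [A [[TW AW TA cT] degT nbT alt]]] :=
    @dense_saturated_structure G M W t Ms Mi _ _ _ nh sat _ few.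
- by rewrite /t; lia.
- lia.
- by rewrite /t; lia.
- by move=> v /minM; rewrite /t; lia.
(* A vertex of [T] has degree [delta - k] in [M], but at least [delta - #|S|]. *)
have cS : #|S| = k.
  have /card_gt0P[x xT] : 0 < #|T| by rewrite cT /t; lia.
  have := minM x (subsetP TW x xT); rewrite degT // /t; lia.
have SA : #|S :|: A| = k + #|A|.
  rewrite cardsU cS disjoint_setI0 ?cards0 ?subn0 //.
  by rewrite disjoint_sym -[S]setCK -subsets_disjoint.
have dis : [disjoint S :|: A & T].
  rewrite -setI_eq0 setIUl [A :&: T]setIC (disjoint_setI0 TA) setU0 setI_eq0.
  by rewrite disjoint_sym -[S]setCK -subsets_disjoint.
have nbG x y : adj x y -> x \in T -> y \in T :|: (S :|: A).
  move=> xy xT; rewrite setUCA in_setU; case: (boolP (y \in S)) => //= yS.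
  by apply: nbT xT _ (eM _ _ xy); rewrite in_setC.
rewrite -cG; case: alt => [A1|[At indep]]; [right|left].
  by apply: (subgraph_L hk dis); rewrite // ?SA ?A1 ?addn1 // cG; lia.
apply: (subgraph_H hk dis); rewrite // ?SA ?At /t; [lia|lia|].
move=> x y xy xT; have := nbG x y xy xT; rewrite in_setU => /orP[yT|//].
by have := indep x y xT yT; rewrite (eM _ _ xy).
Qed.
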